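(* Let $\mathbb{K}$ be an infinite field and let $R=\mathbb{K}[[(\phi_1(t),\psi_1(u)),\ldots,(\phi_n(t),\psi_n(u))]]\subseteq \mathbb{K}[[t]]\times\mathbb{K}[[u]]$ be a two-branch algebroid curve. Let $R^*$ be its Arf closure and let $c=(c[1],c[2])$ be the conductor of the value semigroup $\nu(R^* )\subseteq\mathbb{N}^2$. For each $i$ let $\overline{\phi_i(t)}$ (respectively $\overline{\psi_i(u)}$) be obtained from $\phi_i(t)$ (respectively $\psi_i(u)$) by deleting all monomials of degree greater than $c[1]+1$ (respectively greater than $c[2]+1$), and set $$\overline{R}=\mathbb{K}[[(\overline{\phi_1(t)},\overline{\psi_1(u)}),\ldots,(\overline{\phi_n(t)},\overline{\psi_n(u)})]].$$ Then $R$ and $\overline{R}$ have the same Arf closure: $R^*=\overline{R}^{\,*}$.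
   Context: For $f=(\phi(t),\psi(u))\in\mathbb{K}[[t]]\times\mathbb{K}[[u]]$ put $\nu(f)=(\mathrm{ord}\,\phi,\mathrm{ord}\,\psi)$, with $\mathrm{ord}\,0=\infty$; vectors are compared componentwise. $\mathbb{K}[[f_1,\ldots,f_n]]$ denotes the closure, in the $(t,u)$-adic topology, of the $\mathbb{K}$-subalgebra (containing $(1,1)$) generated by $f_1,\ldots,f_n$; when all $f_i$ have positive order in both components it is the set of all power series in the $f_i$. Two-branch algebroid curve (given by a parametrization): a ring $R=\mathbb{K}[[(\phi_1,\psi_1),\ldots,(\phi_n,\psi_n)]]$ with all $\phi_i,\psi_i$ of positive order, whose integral closure in its total ring of fractions is $\mathbb{K}[[t]]\times\mathbb{K}[[u]]$. Arf closure: a ring $A\subseteq\mathbb{K}[[t]]\times\mathbb{K}[[u]]$ is Arf if for every $x\in A$ with $\nu(x)=\alpha$ having finite components, $x^{-1}A(\alpha)$ is a ring, where $A(\alpha)=\{r\in A:\nu(r)\ge\alpha\}$. The Arf closure $A^*$ of a ring $A$ is the smallest Arf ring containing $A$. $\nu(R^* )$ is the set of values in $\mathbb{N}^2$ of elements of $R^*$, and its conductor is the smallest $c\in\mathbb{N}^2$ with $c+\mathbb{N}^2\subseteq\nu(R^* )$. *)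

(* Defs.v *)
From HB Require Import structures.
From mathcomp Require Import all_boot all_order all_algebra.
From mathcomp Require Import boolp classical_sets functions cardinality.

Set Implicit Arguments.
Unset Strict Implicit.
Unset Printing Implicit Defensive.

Import GRing.Theory.

Local Open Scope classical_set_scope.
Local Open Scope ring_scope.

(* A record rather than an alias of [nat -> K], so that the Cauchy product
   cannot be confused with the pointwise product of functions. *)
Record fps (K : fieldType) := Fps { coefs :> nat -> K }.

Section FpsRing.
Variable K : fieldType.
Implicit Types f g h : fps K.

Lemma fpsP f g : (forall k, f k = g k) -> f = g.
Proof. by case: f g => [f] [g] fg; congr Fps; apply/funext. Qed.

HB.instance Definition _ := gen_eqMixin (fps K).
HB.instance Definition _ := gen_choiceMixin (fps K).

Definition fps_zero : fps K := Fps (fun=> 0).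
Definition fps_one : fps K := Fps (fun k => (k == 0)%:R).
Definition fps_opp f : fps K := Fps (fun k => - f k).
Definition fps_add f g : fps K := Fps (fun k => f k + g k).
Definition fps_mul f g : fps K := Fps (fun k => \sum_(i < k.+1) f i * g (k - i)%N).
Definition fps_scale (a : K) f : fps K := Fps (fun k => a * f k).

Lemma fps_addA : associative fps_add.
Proof. by move=> f g h; apply: fpsP => k /=; rewrite addrA. Qed.

Lemma fps_addC : commutative fps_add.
Proof. by move=> f g; apply: fpsP => k /=; rewrite addrC. Qed.

Lemma fps_add0 : left_id fps_zero fps_add.
Proof. by move=> f; apply: fpsP => k /=; rewrite add0r. Qed.

Lemma fps_addN : left_inverse fps_zero fps_opp fps_add.
Proof. by move=> f; apply: fpsP => k /=; rewrite addNr. Qed.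

HB.instance Definition _ :=
  GRing.isZmodule.Build (fps K) fps_addA fps_addC fps_add0 fps_addN.

Definition fps_poly (n : nat) f : {poly K} := \poly_(i < n) f i.

Lemma fps_mul_poly n k f g : (k < n)%N ->
  fps_mul f g k = (fps_poly n f * fps_poly n g)`_k.
Proof.
move=> kn; rewrite coefM /=; apply: eq_bigr => i _; rewrite !coef_poly.
by rewrite !(leq_ltn_trans _ kn) ?leq_subr // -ltnS ltn_ord.
Qed.

Lemma fps_mulA : associative fps_mul.
Proof.
move=> f g h; apply: fpsP => k; rewrite [LHS]/= [RHS]/=.
transitivity (fps_poly k.+1 f * fps_poly k.+1 g * fps_poly k.+1 h)`_k.
  rewrite -mulrA coefM; apply: eq_bigr => i _; rewrite coef_poly ltn_ord.
  by congr (_ * _); apply: fps_mul_poly; rewrite ltnS leq_subr.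
rewrite coefM; apply: eq_bigr => i _; congr (_ * _).
  exact/esym/fps_mul_poly.
by rewrite coef_poly ltnS leq_subr.
Qed.

Lemma fps_mulC : commutative fps_mul.
Proof.
by move=> f g; apply: fpsP => k; rewrite !(@fps_mul_poly k.+1) // mulrC.
Qed.

Lemma fps_mul1 : left_id fps_one fps_mul.
Proof.
move=> f; apply: fpsP => k; rewrite /= big_ord_recl /= mul1r subn0.
by rewrite big1 ?addr0 // => i _; rewrite mul0r.
Qed.

Lemma fps_mulDl : left_distributive fps_mul fps_add.
Proof.
move=> f g h; apply: fpsP => k /=; rewrite -big_split /=.
by apply: eq_bigr => i _; rewrite mulrDl.
Qed.

Lemma fps_oner_neq0 : fps_one != 0.
Proof.
by apply/eqP => /(congr1 (fun f => coefs f 0)) /= /eqP; rewrite oner_eq0.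
Qed.

HB.instance Definition _ := GRing.Zmodule_isComNzRing.Build (fps K)
  fps_mulA fps_mulC fps_mul1 fps_mulDl fps_oner_neq0.

Lemma fps_scaleA a b f : fps_scale a (fps_scale b f) = fps_scale (a * b) f.
Proof. by apply: fpsP => k /=; rewrite mulrA. Qed.

Lemma fps_scale1 : left_id 1 fps_scale.
Proof. by move=> f; apply: fpsP => k /=; rewrite mul1r. Qed.

Lemma fps_scaleDr : right_distributive fps_scale +%R.
Proof. by move=> a f g; apply: fpsP => k /=; rewrite mulrDr. Qed.

Lemma fps_scaleDl f : {morph fps_scale^~ f : a b / a + b}.
Proof. by move=> a b; apply: fpsP => k /=; rewrite mulrDl. Qed.

HB.instance Definition _ := GRing.Zmodule_isLmodule.Build K (fps K)
  fps_scaleA fps_scale1 fps_scaleDr fps_scaleDl.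

Lemma fps_scaleAl (a : K) f g : a *: (f * g) = a *: f * g.
Proof.
apply: fpsP => k /=; rewrite mulr_sumr.
by apply: eq_bigr => i _; rewrite mulrA.
Qed.

HB.instance Definition _ :=
  GRing.Lmodule_isLalgebra.Build K (fps K) fps_scaleAl.
HB.instance Definition _ := GRing.Lalgebra_isComAlgebra.Build K (fps K).

Definition fps_unit : pred (fps K) := fun f => `[< exists g, g * f = 1 >].
Definition fps_inv f : fps K :=
  if pselect (exists g, g * f = 1) is left e then projT1 (cid e) else f.

Lemma fps_mulVf : {in fps_unit, left_inverse 1 fps_inv *%R}.
Proof.
move=> f /asboolP uf; rewrite /fps_inv; case: pselect => // e.
exact: projT2 (cid e).
Qed.

Lemma fps_unitPl f g : g * f = 1 -> fps_unit f.
Proof. by move=> gf1; apply/asboolP; exists g. Qed.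

Lemma fps_inv_out : {in [predC fps_unit], fps_inv =1 id}.
Proof.
by move=> f /asboolPn nuf; rewrite /fps_inv; case: pselect.
Qed.

HB.instance Definition _ := GRing.ComNzRing_hasMulInverse.Build (fps K)
  fps_mulVf fps_unitPl fps_inv_out.

Lemma fps_neq0_ord f : f != 0 ->
  exists2 m, f m != 0 & forall k, (k < m)%N -> f k = 0.
Proof.
move=> f0; have ex : exists m, f m != 0.
  apply: contrapT => nex; move/eqP: f0; apply; apply: fpsP => k.
  by apply/eqP; apply: contrapT => /negP fk; apply: nex; exists k.
exists (ex_minn ex); case: ex_minnP => // m _ mmin k km.
by apply/eqP; apply: contraLR km => /mmin; rewrite -leqNgt.
Qed.

Lemma fps_mulf_eq0 f g : f * g = 0 -> (f == 0) || (g == 0).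
Proof.
move=> fg0; rewrite -[_ || _]negbK negb_or.
apply/negP => /andP[/fps_neq0_ord[m fm fmin] /fps_neq0_ord[n gn gmin]].
move/(congr1 (fun h => coefs h (m + n))): fg0 => /= /eqP; apply/negP.
have mle : (m < (m + n).+1)%N by rewrite ltnS leq_addr.
rewrite (bigD1 (Ordinal mle)) //= addKn big1 ?addr0 ?mulf_neq0 // => i im.
have [/fmin ->|mi] := ltnP i m; first by rewrite mul0r.
rewrite gmin ?mulr0 // ltn_subLR; last by rewrite -ltnS ltn_ord.
rewrite ltn_add2r ltn_neqAle mi andbT.
by move: im; apply: contra_neq => mE; apply/val_inj.
Qed.

HB.instance Definition _ :=
  GRing.ComUnitRing_isIntegral.Build (fps K) fps_mulf_eq0.

End FpsRing.

Section TwoBranch.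
Variable K : fieldType.

(* [None] stands for the order of 0, which is infinite. *)
Definition ord (f : fps K) : option nat :=
  if pselect (exists k, f k != 0) is left e then Some (ex_minn e) else None.

Definition le_ord (m : nat) (o : option nat) : bool :=
  if o is Some k then (m <= k)%N else true.

Lemma le_ordP m f : le_ord m (ord f) <-> forall k, (k < m)%N -> f k = 0.
Proof.
rewrite /ord; case: pselect => [e|ne] /=; last first.
  by split=> // _ k _; apply: contrapT => /eqP fk; apply: ne; exists k.
case: ex_minnP => d fd dmin; split=> [md k km|fm].
  by apply/eqP; apply: contraLR (leq_trans km md) => /dmin; rewrite -leqNgt.
by rewrite leqNgt; apply/negP => /fm d0; rewrite d0 eqxx in fd.
Qed.

Local Notation fps2 := (fps K * fps K)%type.

Definition nu (f : fps2) : option nat * option nat := (ord f.1, ord f.2).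

Definition fin_val (alpha : nat * nat) : option nat * option nat :=
  (Some alpha.1, Some alpha.2).

Definition nu_ge (alpha : nat * nat) (f : fps2) : Prop :=
  le_ord alpha.1 (nu f).1 /\ le_ord alpha.2 (nu f).2.

Lemma nu_ge_mul alpha x y : nu x = fin_val alpha -> nu_ge alpha (x * y).
Proof.
have mul_ord (m : nat) (f g : fps K) : ord f = Some m -> le_ord m (ord (f * g)).
  move=> fm; have /le_ordP f0 : le_ord m (ord f) by rewrite fm /=.
  apply/le_ordP => k km /=; rewrite big1 // => i _; rewrite f0 ?mul0r //.
  by rewrite (leq_ltn_trans _ km) // -ltnS ltn_ord.
by case=> *; split; apply: mul_ord.
Qed.

Definition le2 (alpha beta : nat * nat) : Prop :=
  (alpha.1 <= beta.1)%N /\ (alpha.2 <= beta.2)%N.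

Definition add2 (alpha beta : nat * nat) : nat * nat :=
  ((alpha.1 + beta.1)%N, (alpha.2 + beta.2)%N).

Definition values (A : set fps2) : set (nat * nat) :=
  [set alpha | exists2 f, A f & nu f = fin_val alpha].

Definition is_conductor (S : set (nat * nat)) (c : nat * nat) : Prop :=
  (forall alpha, S (add2 c alpha)) /\
  (forall c', (forall alpha, S (add2 c' alpha)) -> le2 c c').

Definition trunc (d : nat) (f : fps K) : fps K :=
  Fps (fun k => if (k <= d)%N then f k else 0).

(* The N-th power of the ideal generated by t and u is t^N K[[t]] x u^N K[[u]],
   i.e. the set of elements of value at least (N, N). *)
Definition adic_closure (A : set fps2) : set fps2 :=
  [set g | forall N : nat, exists2 h, A h & nu_ge (N, N) (g - h)].

Definition subalgebra (A : set fps2) : Prop := GRing.subalg_closed (mem A).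

Definition power_series_ring (n : nat) (f : 'I_n -> fps2) : set fps2 :=
  adic_closure (smallest subalgebra (range f)).

(* The total ring of fractions K((t)) x K((u)) of K[[t]] x K[[u]]. *)
Local Notation frac2 := ({fraction fps K} * {fraction fps K})%type.

Definition tofrac2 (f : fps2) : frac2 := (tofrac f.1, tofrac f.2).

Definition nonzerodivisor (A : set fps2) (b : fps2) : Prop :=
  A b /\ forall a, A a -> b * a = 0 -> a = 0.

(* A nonzerodivisor b of A with a zero component is not invertible in frac2;
   then b^-1 = b by convention, and a / b only contributes an element of A.
   As soon as the fractions comprise (1, 0) and (0, 1), hence for every
   two-branch curve, the nonzerodivisors of A are all invertible in frac2. *)
Definition total_fractions (A : set fps2) : set frac2 :=
  [set q | exists a b, [/\ A a, nonzerodivisor A b & q = tofrac2 a / tofrac2 b]].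

Definition integral_over (S : set frac2) (q : frac2) : Prop :=
  exists p : {poly frac2},
    [/\ p \is monic, p \is a polyOver (mem S) & root p q].

Definition normalization (A : set fps2) : set frac2 :=
  [set q | total_fractions A q /\ integral_over (tofrac2 @` A) q].

Definition two_branch_curve (n : nat) (f : 'I_n -> fps2) : Prop :=
  (forall i, nu_ge (1, 1)%N (f i)) /\
  normalization (power_series_ring f) = range tofrac2.

Definition subring (A : set fps2) : Prop := GRing.subring_closed (mem A).

Definition filtration (A : set fps2) (alpha : nat * nat) : set fps2 :=
  [set r | A r /\ nu_ge alpha r].

(* When nu x = alpha is finite, x is a nonzerodivisor dividing in K[[t]] x K[[u]]
   every r with nu r >= alpha: x^-1 A(alpha) consists of the y such that x * y
   is in A(alpha). *)
Definition arf (A : set fps2) : Prop :=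
  subring A /\
  forall x alpha, A x -> nu x = fin_val alpha ->
    subring [set y | filtration A alpha (x * y)].

Definition arf_closure (A : set fps2) : set fps2 := smallest arf A.

(* Arf rings are stable under intersection, so that [smallest], which is an
   intersection, does yield the smallest Arf ring containing A. *)
Lemma arf_arf_closure (A : set fps2) : arf (arf_closure A).
Proof.
have sub_bigcap (F : set fps2 -> set fps2) (D : set (set fps2)) :
    (forall B, D B -> subring (F B)) -> subring (\bigcap_(B in D) F B).
  move=> HF; split.
  - by rewrite in_setE => B /HF[]; rewrite in_setE.
  - move=> x y; rewrite !in_setE => xF yF B DB.
    have [_ subF _] := HF B DB; apply: set_mem; apply: subF; apply: mem_set.
      exact: xF.
    exact: yF.
  - move=> x y; rewrite !in_setE => xF yF B DB.
    have [_ _ mulF] := HF B DB; apply: set_mem; apply: mulF; apply: mem_set.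
      exact: xF.
    exact: yF.
split; first by apply: (sub_bigcap id) => B [[]].
move=> x alpha xA nux.
pose F B := [set y | filtration B alpha (x * y)].
rewrite (_ : mkset _ = \bigcap_(B in [set M | arf M /\ A `<=` M]) F B).
  apply: sub_bigcap => B BP; have [[_ arfB] _] := BP.
  by apply: arfB => //; apply: xA.
apply/seteqP; split=> y.
  by move=> [xyA ge] B BP; split => //; apply: xyA.
by move=> yF; split => [B /yF[]|] //; apply: nu_ge_mul.
Qed.

End TwoBranch.

(* Main.v *)
Require Import Defs.
From mathcomp Require Import all_boot all_order all_algebra.
From mathcomp Require Import boolp classical_sets functions cardinality.
From mathcomp Require Import ring.

Set Implicit Arguments.
Unset Strict Implicit.
Unset Printing Implicit Defensive.

Import GRing.Theory.

Local Open Scope classical_set_scope.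
Local Open Scope ring_scope.

(** Write [J a] for the elements of value at least [a], [O] for
    [K[[t]] x K[[u]]], [S] for the truncated ring and [B] for its Arf closure.
    The fractions of [S] lying in [O] form an Arf ring, so every element of [B]
    is a fraction of [S].  If such fractions have enough values, a common
    denominator for finitely many of them shows, since [S] is complete, that
    [S] contains some [J a].  Applied to [R], this gives [J c <= R^*], whence
    [B <= R^*].  Conversely, [B + J (c + 2)] is again Arf (this is the key
    lemma) and contains [R], hence [R^*].  So [B] contains some [b] of value
    [c], and modulo [J (2, 2)] the ring [L] of the [l] with [b * l] in [B] is
    all of [O].  Powers of approximations of [(t, 0)] and [(0, u)] in [L] then
    give fractions of [S] of enough values; hence [S] contains some [J a],
    [L = O] and [J c <= B].  As the generators of [R] differ from those of [S]
    by elements of [J c], they lie in [B], so [R^* <= B]. *)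

(** * Power series in one variable: orders, units and divisibility *)

Section Fps.
Variable K : fieldType.
Implicit Types f g h : fps K.

Definition vanishes (m : nat) f := forall k, (k < m)%N -> f k = 0.

Lemma coefs_sum n (F : 'I_n -> fps K) k : (\sum_i F i) k = \sum_i F i k.
Proof. by apply: (big_morph (fun f : fps K => f k)). Qed.

Lemma vanishes_le m n f : (m <= n)%N -> vanishes n f -> vanishes m f.
Proof. by move=> mn fn k km; apply/fn/(leq_trans km). Qed.

Lemma vanishesD m f g : vanishes m f -> vanishes m g -> vanishes m (f + g).
Proof. by move=> f0 g0 k km; rewrite /= f0 // g0 // addr0. Qed.

Lemma vanishesN m f : vanishes m f -> vanishes m (- f).
Proof. by move=> f0 k km; rewrite /= f0 // oppr0. Qed.

Lemma vanishesM m n f g :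
  vanishes m f -> vanishes n g -> vanishes (m + n) (f * g).
Proof.
move=> f0 g0 k kmn /=; rewrite big1 // => i _.
have [im|mi] := ltnP i m; first by rewrite f0 ?mul0r.
rewrite g0 ?mulr0 // ltn_subLR; last by rewrite -ltnS ltn_ord.
by rewrite (leq_trans kmn) // leq_add2r.
Qed.

Lemma vanishesX m f n : vanishes m f -> vanishes (n * m) (f ^+ n).
Proof.
move=> f0; elim: n => [|n IH]; first by move=> k.
by rewrite exprS mulSn; apply: vanishesM.
Qed.

Lemma coefsM_lead m n f g :
  vanishes m f -> vanishes n g -> (f * g) (m + n)%N = f m * g n.
Proof.
move=> f0 g0 /=; have mle : (m < (m + n).+1)%N by rewrite ltnS leq_addr.
rewrite (bigD1 (Ordinal mle)) //= addKn big1 ?addr0 // => i im.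
have [/f0 ->|mi] := ltnP i m; first by rewrite mul0r.
rewrite g0 ?mulr0 // ltn_subLR; last by rewrite -ltnS ltn_ord.
rewrite ltn_add2r ltn_neqAle mi andbT.
by move: im; apply: contra_neq => mE; apply/val_inj.
Qed.

Lemma coefsX_lead m f n : vanishes m f -> (f ^+ n) (n * m)%N = f m ^+ n.
Proof.
move=> f0; elim: n => [|n IH]; first by [].
by rewrite !exprS mulSn coefsM_lead ?IH //; apply: vanishesX.
Qed.

Lemma ordP m f : ord f = Some m <-> vanishes m f /\ f m != 0.
Proof.
rewrite /ord; case: pselect => [e|ne]; last first.
  by split=> // -[_ fm]; case: ne; exists m.
case: ex_minnP => d fd dmin; split=> [[<-]|[f0 fm]].
  split=> // k kd; apply/eqP; apply: contraLR kd => /dmin.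
  by rewrite -leqNgt.
congr Some; apply/eqP; rewrite eqn_leq dmin //= leqNgt.
by apply/negP => /f0 d0; rewrite d0 eqxx in fd.
Qed.

Lemma ord_neq0 f : f <> 0 -> exists n, ord f = Some n.
Proof. by move=> /eqP/fps_neq0_ord[n fn nmin]; exists n; apply/ordP. Qed.

Lemma ord_mul m n f g :
  ord f = Some m -> ord g = Some n -> ord (f * g) = Some (m + n)%N.
Proof.
move=> /ordP[f0 fm] /ordP[g0 gn]; apply/ordP; split; first exact: vanishesM.
by rewrite coefsM_lead // mulf_neq0.
Qed.

(** Orders add because [fps K] is a domain. Truncation of [n - m] is harmless: for [n <= m] both
    sides hold. *)
Lemma vanishes_mulP m n f g :
  ord f = Some m -> vanishes n (f * g) <-> vanishes (n - m) g.
Proof.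
move=> ordf; have [f0 fm] := (ordP m f).1 ordf.
split=> [fg0|g0]; last first.
  by apply: vanishes_le (vanishesM f0 g0); rewrite -leq_subLR.
have [->|/eqP gN0] := eqVneq g 0; first by [].
have [l ordg] := ord_neq0 gN0.
have [_ fgN0] := (ordP _ _).1 (ord_mul ordf ordg).
have nml : (n <= m + l)%N.
  by rewrite leqNgt; apply/negP => /fg0 E; rewrite E eqxx in fgN0.
have [gl _] := (ordP _ _).1 ordg.
by apply: vanishes_le gl; rewrite leq_subLR.
Qed.

Definition fps_monomial m : fps K := Fps (fun k => (k == m)%:R).

Lemma fps_monomialM m f k : (fps_monomial m * f) k =
  if (k < m)%N then 0 else f (k - m)%N.
Proof.
have X0 : vanishes m (fps_monomial m) by move=> i im /=; rewrite ltn_eqF.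
have [km|mk] := ltnP; first by apply: (@vanishesM m 0) => //; rewrite addn0.
rewrite /=; have mle : (m < k.+1)%N by rewrite ltnS.
rewrite (bigD1 (Ordinal mle)) //= eqxx mul1r big1 ?addr0 // => i im.
rewrite (_ : (i == m :> nat) = false) ?mul0r //.
by apply: negbTE; move: im; apply: contra_neq => mE; apply/val_inj.
Qed.

Lemma vanishes_monomial m f : vanishes m f -> exists g, f = fps_monomial m * g.
Proof.
move=> f0; exists (Fps (fun k => f (k + m)%N)); apply: fpsP => k.
rewrite fps_monomialM; have [/f0 //|mk] := ltnP.
by rewrite /= subnK.
Qed.

(** Geometric series in [w]. As [w] has no constant term, the coefficient of degree [k] of the
    partial sums is stable from [s k.+1] on, and the inverse takes it from there. *)
Lemma unit_fps f : f 0%N != 0 -> exists g, f * g = 1.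
Proof.
move=> fN0; pose w : fps K := 1 - (f 0%N)^-1 *: f.
have fE : f = f 0%N *: (1 - w) by rewrite /w subKr scalerA divff // scale1r.
have w0 : vanishes 1 w by case=> // _ /=; rewrite mulVf // subrr.
have wX n : vanishes n (w ^+ n).
  by have := @vanishesX 1 w n w0; rewrite muln1.
pose s n : fps K := (f 0%N)^-1 *: \sum_(i < n) w ^+ i.
have sE m n : (m <= n)%N -> vanishes m (s n - s m).
  move=> mn; rewrite -scalerBr -(subnKC mn) big_split_ord /= addrAC.
  rewrite subrr add0r => k km /=; rewrite coefs_sum big1 ?mulr0 // => j _.
  by apply: wX; rewrite (leq_trans km) // leq_addr.
have fsE n : f * s n = 1 - w ^+ n.
  rewrite /s {1}fE -scalerAl -scalerAr scalerA divff // scale1r.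
  by rewrite -(opprB w 1) mulNr -subrX1 opprB.
exists (Fps (fun k => s k.+1 k)); apply: fpsP => k.
rewrite -[RHS]subr0 -[X in _ = _ - X](wX k.+1 k) //.
rewrite -[RHS]/((1 - w ^+ k.+1) k) -fsE /=.
apply: eq_bigr => i _; congr (_ * _).
have ki : ((k - i).+1 <= k.+1)%N by rewrite ltnS leq_subr.
have /eqP := sE _ _ ki (k - i)%N (ltnSn _).
by rewrite /= subr_eq0 => /eqP.
Qed.

(** Once the monomial of degree [m] is split off both series, the cofactor of [f] is a unit. *)
Lemma fps_divides m f g : ord f = Some m -> vanishes m g -> exists h, g = f * h.
Proof.
move=> /ordP[/vanishes_monomial[f' ->] fm] /vanishes_monomial[g' ->].
have {fm} : f' 0%N != 0 by move: fm; rewrite fps_monomialM ltnn subnn.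
by move=> /unit_fps[h fh]; exists (h * g'); rewrite -mulrA (mulrA f') fh mul1r.
Qed.

End Fps.

(** * Value vectors of pairs of power series *)

Section Values.
Variable K : fieldType.
Local Notation fps2 := (fps K * fps K)%type.
Implicit Types (f g x y : fps2) (a b : nat * nat).

Lemma nu_geP a f : nu_ge a f <-> vanishes a.1 f.1 /\ vanishes a.2 f.2.
Proof. by split=> -[/le_ordP ? /le_ordP ?]. Qed.

Lemma nuP a f : nu f = fin_val a <-> ord f.1 = Some a.1 /\ ord f.2 = Some a.2.
Proof. by split=> [[]|[f1 f2]] //; rewrite /nu f1 f2. Qed.

Lemma nu_ge00 f : nu_ge (0, 0)%N f.
Proof. by apply/nu_geP. Qed.

Lemma nu_ge_le a b f : le2 a b -> nu_ge b f -> nu_ge a f.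
Proof.
move=> [ab1 ab2] /nu_geP[f1 f2]; apply/nu_geP.
by split; [apply: vanishes_le f1|apply: vanishes_le f2].
Qed.

Lemma nu_ge0 a : nu_ge a (0 : fps2).
Proof. by apply/nu_geP; split. Qed.

Lemma nu_geD a f g : nu_ge a f -> nu_ge a g -> nu_ge a (f + g).
Proof.
move=> /nu_geP[f1 f2] /nu_geP[g1 g2].
by apply/nu_geP; split; apply: vanishesD.
Qed.

Lemma nu_geN a f : nu_ge a f -> nu_ge a (- f).
Proof. by move=> /nu_geP[f1 f2]; apply/nu_geP; split; apply: vanishesN. Qed.

Lemma nu_geB a f g : nu_ge a f -> nu_ge a g -> nu_ge a (f - g).
Proof. by move=> fa ga; apply: nu_geD => //; apply: nu_geN. Qed.

Lemma nu_geM a b f g :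
  nu_ge a f -> nu_ge b g -> nu_ge (add2 a b) (f * g).
Proof.
move=> /nu_geP[f1 f2] /nu_geP[g1 g2].
by apply/nu_geP; split; apply: vanishesM.
Qed.

Lemma nu_ge_mulr a f g : nu_ge a f -> nu_ge a (f * g).
Proof.
move=> fa; apply: nu_ge_le (nu_geM fa (nu_ge00 g)).
by split; rewrite /= leq_addr.
Qed.

Lemma nu_ge_mull a f g : nu_ge a g -> nu_ge a (f * g).
Proof. by rewrite mulrC; apply: nu_ge_mulr. Qed.

Lemma nu_geX a f n : nu_ge a f -> nu_ge (n * a.1, n * a.2)%N (f ^+ n).
Proof.
move=> fa; elim: n => [|n IH]; first exact: nu_ge00.
by rewrite exprS; exact: (nu_geM fa IH).
Qed.

Lemma nu_geX1 f n : nu_ge (1, 1)%N f -> nu_ge (n, n) (f ^+ n).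
Proof. by move=> f1; have := nu_geX n f1; rewrite /= !muln1. Qed.

Lemma nu_fin_ge a f : nu f = fin_val a -> nu_ge a f.
Proof. by move=> /nuP[/ordP[f1 _] /ordP[f2 _]]; apply/nu_geP. Qed.

Lemma nu_mul a b f g : nu f = fin_val a -> nu g = fin_val b ->
  nu (f * g) = fin_val (add2 a b).
Proof.
by move=> /nuP[f1 f2] /nuP[g1 g2]; apply/nuP; split; apply: ord_mul.
Qed.

Lemma nu_one : nu (1 : fps2) = fin_val (0, 0)%N.
Proof. by apply/nuP; split; apply/ordP; split=> //=; rewrite oner_eq0. Qed.

Lemma nu_exp a f n : nu f = fin_val a ->
  nu (f ^+ n) = fin_val (n * a.1, n * a.2)%N.
Proof.
move=> fa; elim: n => [|n IH]; first exact: nu_one.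
by rewrite exprS (nu_mul fa IH).
Qed.

(** Subtraction is truncated: where [b] exceeds [a] the bound becomes 0 and imposes nothing. *)
Definition sub2 a b : nat * nat := ((a.1 - b.1)%N, (a.2 - b.2)%N).

Lemma nu_ge_mulP a b f g : nu f = fin_val a ->
  nu_ge b (f * g) <-> nu_ge (sub2 b a) g.
Proof.
move=> /nuP[f1 f2]; split=> /nu_geP[h1 h2]; apply/nu_geP.
  by split; [apply/(vanishes_mulP _ _ f1)|apply/(vanishes_mulP _ _ f2)].
by split; [apply/(vanishes_mulP _ _ f1)|apply/(vanishes_mulP _ _ f2)].
Qed.

Lemma add2K a b : sub2 (add2 a b) a = b.
Proof. by case: b => ? ?; rewrite /sub2 /= !addKn. Qed.

Lemma nu_ge_cancel a b f g : nu f = fin_val a ->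
  nu_ge (add2 a b) (f * g) -> nu_ge b g.
Proof. by move=> fa /(nu_ge_mulP _ _ fa); rewrite add2K. Qed.

Lemma nu_divides a f g : nu f = fin_val a -> nu_ge a g -> exists h, g = f * h.
Proof.
case: f g => [f1 f2] [g1 g2] /nuP[/= fa1 fa2] /nu_geP[/= ga1 ga2].
have [h1 ->] := fps_divides fa1 ga1; have [h2 ->] := fps_divides fa2 ga2.
by exists (h1, h2).
Qed.

End Values.

(** * Subalgebras, colon rings, Arf closures and adic closures *)

Section Subalgebras.
Variable K : fieldType.
Local Notation fps2 := (fps K * fps K)%type.
Implicit Types (A B S : set fps2) (f g x y : fps2) (a b : nat * nat).

Lemma subringP A : subring A <->
  [/\ A 1, forall x y, A x -> A y -> A (x - y)
    & forall x y, A x -> A y -> A (x * y)].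
Proof.
split=> -[]; rewrite ?in_setE => A1 AB AM; split; rewrite ?in_setE // => x y.
- by move: (AB x y); rewrite !in_setE; apply.
- by move: (AM x y); rewrite !in_setE; apply.
- by rewrite !in_setE; apply: AB.
- by rewrite !in_setE; apply: AM.
Qed.

Lemma subalgebraP A : subalgebra A <->
  [/\ A 1, forall k x y, A x -> A y -> A (k *: x + y)
    & forall x y, A x -> A y -> A (x * y)].
Proof.
split=> -[]; rewrite ?in_setE => A1 AD AM; split; rewrite ?in_setE //.
- by move=> k x y; move: (AD k x y); rewrite !in_setE; apply.
- by move=> x y; move: (AM x y); rewrite !in_setE; apply.
- by move=> k x y; rewrite !in_setE; apply: AD.
- by move=> x y; rewrite !in_setE; apply: AM.
Qed.

Section Closure.
Variables (A : set fps2) (algA : subalgebra A).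

Lemma alg1 : A 1. Proof. by have /subalgebraP[] := algA. Qed.

Lemma algM x y : A x -> A y -> A (x * y).
Proof. by have /subalgebraP[_ _] := algA; apply. Qed.

Lemma algD x y : A x -> A y -> A (x + y).
Proof.
have /subalgebraP[_ AD _] := algA; move=> Ax Ay.
by rewrite -[x]scale1r; apply: AD.
Qed.

Lemma algB x y : A x -> A y -> A (x - y).
Proof.
have /subalgebraP[_ AD _] := algA.
by rewrite addrC -scaleN1r => ? ?; apply: AD.
Qed.

Lemma alg0 : A 0. Proof. by rewrite -(subrr 1); apply: algB; apply: alg1. Qed.

Lemma algZ k x : A x -> A (k *: x).
Proof.
have /subalgebraP[_ AD _] := algA.
by rewrite -[k *: x]addr0 => Ax; apply: AD => //; apply: alg0.
Qed.

Lemma algX x n : A x -> A (x ^+ n).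
Proof.
move=> Ax; elim: n => [|n IH]; first exact: alg1.
by rewrite exprS; apply: algM.
Qed.

Lemma alg_sum n (F : 'I_n -> fps2) : (forall i, A (F i)) -> A (\sum_i F i).
Proof.
move=> AF; apply: (big_ind A) => //; first exact: alg0.
exact: algD.
Qed.

Lemma algBl x y : A x -> A (x - y) -> A y.
Proof. by move=> Ax Axy; rewrite -(subKr x y); apply: algB. Qed.

End Closure.

(** Arf closures are defined through subrings only; once the constants are inside, scaling is
    multiplication by them. *)
Lemma subring_subalgebra A :
  subring A -> (forall k : K, A (k *: 1)) -> subalgebra A.
Proof.
move=> /subringP[A1 AB AM] Ak; apply/subalgebraP; split=> // k x y Ax Ay.
rewrite -[y]opprK; apply: (AB); last first.
  by rewrite -sub0r; apply: (AB) => //; rewrite -(subrr 1); apply: (AB).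
by rewrite -[x]mul1r scalerAl; apply: AM.
Qed.

Lemma subalgebra_subring A : subalgebra A -> subring A.
Proof.
by move=> algA; apply/subringP; split; [exact: alg1|exact: algB|exact: algM].
Qed.

(* For [x] of finite value this is the paper's [x^-1 A(nu x)]. *)
Definition colon A x : set fps2 := [set y | A (x * y)].

Lemma colon_subalgebra A x a : subalgebra A -> arf A -> A x ->
  nu x = fin_val a -> subalgebra (colon A x).
Proof.
move=> algA [_ arfA] Ax xa; have /subringP[L1 LB LM] := arfA _ _ Ax xa.
have ge y : nu_ge a (x * y) by apply: nu_ge_mul.
have LE y : filtration A a (x * y) <-> colon A x y by split=> [[]|].
apply: subring_subalgebra => [|k].
  apply/subringP; split; first by case: L1.
    by move=> y z /LE yL /LE zL; case: (LB y z yL zL).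
  by move=> y z /LE yL /LE zL; case: (LM y z yL zL).
by rewrite /colon /= -scalerAr mulr1; apply: algZ.
Qed.

(** Every multiple of [x] satisfies the bound of the filtration, and [A] itself provides differences
    and 1, so only products remain to be checked. *)
Lemma arfI A : subalgebra A ->
  (forall x a, A x -> nu x = fin_val a -> forall y z,
     colon A x y -> colon A x z -> colon A x (y * z)) ->
  arf A.
Proof.
move=> algA AM; split; first exact: subalgebra_subring.
move=> x a Ax xa; have ge y : nu_ge a (x * y) by apply: nu_ge_mul.
apply/subringP; split.
- by split=> //; rewrite mulr1.
- by move=> y z [xy _] [xz _]; split=> //; rewrite mulrBr; apply: algB.
- by move=> y z [xy _] [xz _]; split=> //; apply: (AM x a).
Qed.

Lemma sub_arf_closure A : A `<=` arf_closure A.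
Proof. exact: sub_smallest. Qed.

Lemma arf_closure_min A B : arf B -> A `<=` B -> arf_closure A `<=` B.
Proof. by move=> arfB AB; apply: smallest_sub. Qed.

Lemma arf_closure_subalgebra A : subalgebra A -> subalgebra (arf_closure A).
Proof.
move=> algA; apply: subring_subalgebra; first by case: (arf_arf_closure A).
by move=> k; apply: sub_arf_closure; apply: algZ => //; apply: alg1.
Qed.

Definition generated (n : nat) (f : 'I_n -> fps2) : set fps2 :=
  smallest (@subalgebra K) (range f).

Lemma generated_subalgebra n (f : 'I_n -> fps2) : subalgebra (generated f).
Proof.
apply/subalgebraP; split=> [B [algB _]|k x y xF yF B|x y xF yF B].
- exact: alg1.
- by move=> BP; have [algB _] := BP; apply: algD => //;
    [apply: algZ => //; exact: xF|exact: yF].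
- by move=> BP; have [algB _] := BP; apply: algM; [|exact: xF|exact: yF].
Qed.

Lemma adic_closure_subalgebra A : subalgebra A -> subalgebra (adic_closure A).
Proof.
move=> algA; apply/subalgebraP; split=> [N|k x y xA yA N|x y xA yA N].
- by exists 1; [exact: alg1|rewrite subrr; apply: nu_ge0].
- have [[u Au xu] [v Av yv]] := (xA N, yA N).
  exists (k *: u + v); first by apply: algD => //; apply: algZ.
  rewrite opprD addrACA -scalerBr; apply: nu_geD => //.
  by rewrite -[x - u]mul1r scalerAl; apply: nu_ge_mull.
- have [[u Au xu] [v Av yv]] := (xA N, yA N).
  exists (u * v); first exact: algM.
  rewrite (_ : _ - _ = (x - u) * y + u * (y - v)); last by ring.
  by apply: nu_geD; [apply: nu_ge_mulr|apply: nu_ge_mull].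
Qed.

Lemma sub_adic_closure A : A `<=` adic_closure A.
Proof. by move=> x Ax N; exists x; rewrite // subrr; apply: nu_ge0. Qed.

Lemma adic_closure_closed A : adic_closure (adic_closure A) `<=` adic_closure A.
Proof.
move=> x xA N; have [y /(_ N)[z Az yz] xy] := xA N; exists z => //.
by rewrite -(subrKA y); apply: nu_geD.
Qed.

(** Approximation to the larger of the orders [a.1] and [a.2] leaves an error in [nu_ge a]. For such
    [A], containing a power series ring amounts to containing its generators. *)
Lemma closed_of_ideal A a : subalgebra A ->
  nu_ge a `<=` A -> adic_closure A `<=` A.
Proof.
move=> algA aA x /(_ (maxn a.1 a.2))[y Ay xy].
rewrite -(subrK y x); apply: algD => //; apply: aA; apply: nu_ge_le xy.
by split; rewrite ?leq_maxl ?leq_maxr.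
Qed.

Lemma power_series_subalgebra n (f : 'I_n -> fps2) :
  subalgebra (power_series_ring f).
Proof. by apply: adic_closure_subalgebra; apply: generated_subalgebra. Qed.

Lemma power_series_gen n (f : 'I_n -> fps2) i : power_series_ring f (f i).
Proof.
by apply: sub_adic_closure => A [_ fA]; apply: fA; exists i => //.
Qed.

Lemma power_series_min n (f : 'I_n -> fps2) A : subalgebra A ->
  adic_closure A `<=` A -> (forall i, A (f i)) -> power_series_ring f `<=` A.
Proof.
move=> algA closedA Af x xR; apply: closedA => N.
have [y yF xy] := xR N; exists y => //; apply: yF; split=> //.
by move=> _ [i _ <-].
Qed.

End Subalgebras.

(** * Fractions of a subalgebra and common denominators *)

Section Denominators.
Variable K : fieldType.
Local Notation fps2 := (fps K * fps K)%type.
Implicit Types (A B S : set fps2) (f g x y : fps2) (a b c : nat * nat).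

(** These are the quotients of elements of [S] that lie in [K[[t]] x K[[u]]]; finite value means
    that both components of the denominator are nonzero. *)
Definition fractions S : set fps2 :=
  [set f | exists w a, [/\ S w, nu w = fin_val a & S (w * f)]].

Lemma sub_fractions S : subalgebra S -> S `<=` fractions S.
Proof.
move=> algS f Sf; exists 1, (0, 0)%N; split; first exact: alg1.
  exact: nu_one.
by rewrite mul1r.
Qed.

Lemma fractions_subalgebra S : subalgebra S -> subalgebra (fractions S).
Proof.
move=> algS; apply/subalgebraP; split.
- by apply: sub_fractions => //; apply: alg1.
- move=> k x y [v [a [Sv va Svx]]] [w [b [Sw wb Swy]]].
  exists (v * w), (add2 a b); split; [exact: algM|exact: nu_mul|].
  rewrite (_ : _ * _ = k *: (w * (v * x)) + v * (w * y)).
    by apply: algD => //; [apply: algZ => //|]; apply: algM.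
  by rewrite mulrDr -scalerAr; congr (_ *: _ + _); ring.
- move=> x y [v [a [Sv va Svx]]] [w [b [Sw wb Swy]]].
  exists (v * w), (add2 a b); split; [exact: algM|exact: nu_mul|].
  by rewrite mulrACA; apply: algM.
Qed.

(* Hence each colon of [fractions S] is [fractions S] itself. *)
Lemma fractions_cancel S x a y : subalgebra S -> nu x = fin_val a ->
  fractions S x -> fractions S (x * y) -> fractions S y.
Proof.
move=> algS xa [v [b [Sv vb Svx]]] [w [d [Sw wd Swxy]]].
exists (w * (v * x)), (add2 d (add2 b a)); split; first exact: algM.
  exact: nu_mul wd (nu_mul vb xa).
by rewrite (_ : _ * _ = v * (w * (x * y))); [apply: algM|ring].
Qed.

Lemma arf_fractions S : subalgebra S -> arf (fractions S).
Proof.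
move=> algS; have algF := fractions_subalgebra algS.
apply: arfI => // x a Fx xa y z xy xz; apply: (algM algF Fx).
by apply: algM => //; apply: fractions_cancel xa Fx _.
Qed.

Lemma arf_closure_fractions S : subalgebra S -> arf_closure S `<=` fractions S.
Proof.
move=> algS; apply: arf_closure_min; first exact: arf_fractions.
exact: sub_fractions.
Qed.

(** Such elements clear the coefficients of degrees [c.1 + k] and [c.2 + k] independently. The other
    component is only bounded below, so it may be zero. *)
Definition staircase (V : set fps2) c : Prop := forall k,
  (exists x,
     [/\ V x, nu_ge (c.1 + k, c.2 + k.+1)%N x & x.1 (c.1 + k)%N != 0]) /\
  (exists y,
     [/\ V y, nu_ge (c.1 + k.+1, c.2 + k)%N y & y.2 (c.2 + k)%N != 0]).

Lemma staircase_sub A B c : A `<=` B -> staircase A c -> staircase B c.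
Proof.
move=> AB Ac k; have [[x [Ax xc x0]] [y [Ay yc y0]]] := Ac k.
by split; [exists x|exists y]; split=> //; apply: AB.
Qed.

Lemma staircase_values V c : (forall a, values V (add2 c a)) -> staircase V c.
Proof.
move=> Vc k; split.
  have [x Vx xc] := Vc (k, k.+1); exists x.
  split=> //; first exact: nu_fin_ge xc.
  by have /nuP[/ordP[]] := xc.
have [x Vx xc] := Vc (k.+1, k); exists x.
split=> //; first exact: nu_fin_ge xc.
by have /nuP[_ /ordP[]] := xc.
Qed.

(** [x] clears the first coefficient and [y] the second; neither disturbs the other, since its
    opposite component starts one degree later. *)
Lemma staircase_step c k x y f :
  nu_ge (c.1 + k, c.2 + k.+1)%N x -> x.1 (c.1 + k)%N != 0 ->
  nu_ge (c.1 + k.+1, c.2 + k)%N y -> y.2 (c.2 + k)%N != 0 ->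
  nu_ge (c.1 + k, c.2 + k)%N f ->
  exists p q : K, nu_ge (c.1 + k.+1, c.2 + k.+1)%N (f - (p *: x + q *: y)).
Proof.
move=> /nu_geP[/= x1 x2] xk /nu_geP[/= y1 y2] yk /nu_geP[/= f1 f2].
exists (f.1 (c.1 + k)%N / x.1 (c.1 + k)%N), (f.2 (c.2 + k)%N / y.2 (c.2 + k)%N).
apply/nu_geP; split=> i /=; rewrite addnS ltnS leq_eqVlt => /predU1P[->|ik] /=.
- by rewrite (y1 (c.1 + k)%N) ?addnS // mulr0 addr0 divfK // subrr.
- by rewrite (f1 i) // (x1 i) // (y1 i) ?addnS 1?ltnW // !mulr0 addr0 subr0.
- by rewrite (x2 (c.2 + k)%N) ?addnS // mulr0 add0r divfK // subrr.
- by rewrite (f2 i) // (y2 i) // (x2 i) ?addnS 1?ltnW // !mulr0 addr0 subr0.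
Qed.

Lemma staircase_approx A c : subalgebra A -> staircase A c ->
  forall M f, nu_ge c f ->
  exists2 v, A v & nu_ge (c.1 + M, c.2 + M)%N (f - v).
Proof.
move=> algA Ac; elim=> [|M IH] f fc.
  exists 0; first exact: alg0.
  by rewrite subr0 !addn0 -surjective_pairing.
have [v Av fv] := IH f fc.
have [[x [Ax xc x0]] [y [Ay yc y0]]] := Ac M.
have [p [q fpq]] := staircase_step xc x0 yc y0 fv.
exists (v + (p *: x + q *: y)); last by rewrite opprD addrA.
by do 2?apply: algD => //; apply: algZ.
Qed.

(** Successive clearing ends with an error in [nu_ge a]. This trades an ideal with uncontrolled [a]
    for the sharp [nu_ge c]. *)
Lemma staircase_ideal A c a : subalgebra A -> staircase A c ->
  nu_ge a `<=` A -> nu_ge c `<=` A.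
Proof.
move=> algA Ac aA f fc.
have [v Av fv] := staircase_approx algA Ac (maxn a.1 a.2) fc.
rewrite -(subrK v f); apply: algD => //; apply: aA; apply: nu_ge_le fv.
by split; rewrite /= ?(leq_trans (leq_maxl _ _) (leq_addl _ _))
  ?(leq_trans (leq_maxr _ _) (leq_addl _ _)).
Qed.

(** [w] does not depend on [f]: it is the product of the denominators of the staircase elements of
    the first [M] levels. *)
Lemma staircase_denominator S c : subalgebra S -> staircase (fractions S) c ->
  forall M, exists w a, [/\ S w, nu w = fin_val a &
    forall f, nu_ge c f ->
    exists2 s, S (w * s) & nu_ge (c.1 + M, c.2 + M)%N (f - s)].
Proof.
move=> algS Sc; elim=> [|M [w [a [Sw wa wM]]]].
  exists 1, (0, 0)%N; split; [exact: alg1|exact: nu_one|move=> f fc].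
  exists 0; first by rewrite mulr0; apply: alg0.
  by rewrite subr0 !addn0 -surjective_pairing.
have [[x [[wx [ax [Swx wxa Sx]]] xc x0]] [y [[wy [ay [Swy wya Sy]]] yc y0]]] :=
  Sc M.
exists (w * (wx * wy)), (add2 a (add2 ax ay)); split.
- by do 2?apply: algM.
- exact: nu_mul wa (nu_mul wxa wya).
move=> f fc; have [s Ss fs] := wM f fc.
have [p [q fpq]] := staircase_step xc x0 yc y0 fs.
exists (s + (p *: x + q *: y)); last by rewrite opprD addrA.
(* Each summand isolates a product known to lie in [S]: [w * s], [wx * x] or [wy * y]. *)
rewrite (_ : _ * _ = wx * wy * (w * s) +
  (p *: (w * wy * (wx * x)) + q *: (w * wx * (wy * y)))).
  by do 2?[apply: algD => //]; try apply: algZ => //; do 3?apply: algM => //.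
by rewrite !mulrDr -!scalerAr; congr (_ + (_ *: _ + _ *: _)); ring.
Qed.

(* With [w] a common denominator of finitely many elements spanning [nu_ge c]
   modulo [e], every [w * f] is an [e]-adic limit of elements of [S]. *)
Lemma fractions_ideal S c d e : subalgebra S -> adic_closure S `<=` S ->
  S e -> nu e = fin_val d -> nu_ge (1, 1)%N e -> staircase (fractions S) c ->
  exists a, nu_ge a `<=` S.
Proof.
move=> algS closedS Se ed e1 Sc.
(* This precision puts the error [g - r] below in [nu_ge (add2 d c)]: its quotient by [e] is again
   in [nu_ge c], and the approximation can be iterated. *)
have [w [a [Sw wa wM]]] := staircase_denominator algS Sc (maxn d.1 d.2).
have eN N f : nu_ge c f ->
    exists s g, [/\ S (w * s), nu_ge c g & f - s = e ^+ N * g].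
  elim: N f => [|N IH] f fc.
    exists 0, f; rewrite mulr0 subr0 mul1r; split=> //; exact: alg0.
  have [s [g [Ss gc fsE]]] := IH f fc; have [r Sr gr] := wM g gc.
  have {}gr : nu_ge (add2 d c) (g - r).
    apply: nu_ge_le gr; split; rewrite /= addnC leq_add2l.
      exact: leq_maxl.
    exact: leq_maxr.
  have [h hE] : exists h, g - r = e * h.
    apply: nu_divides ed _; apply: nu_ge_le gr.
    by split; rewrite /= leq_addr.
  exists (s + e ^+ N * r), h; split.
  - by rewrite mulrDr mulrCA; apply: algD => //; apply: algM => //; apply: algX.
  - by apply: (nu_ge_cancel ed); rewrite -hE.
  - by rewrite opprD addrA fsE -mulrBr hE exprSr mulrA.
exists (add2 a c) => f fac; apply: closedS => N.
have [g fE] : exists g, f = w * g.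
  apply: nu_divides wa _; apply: nu_ge_le fac.
  by split; rewrite /= leq_addr.
have gc : nu_ge c g by apply: (nu_ge_cancel wa); rewrite -fE.
have [s [h [Ss hc gsE]]] := eN N g gc.
exists (w * s) => //; rewrite fE -mulrBr gsE.
by apply: nu_ge_mull; apply: nu_ge_mulr; apply: nu_geX1.
Qed.

End Denominators.

(** * Enlarging an Arf ring by an ideal [nu_ge a] *)

Section Thickening.
Variable K : fieldType.
Local Notation fps2 := (fps K * fps K)%type.
Implicit Types (A B : set fps2) (f g x y : fps2) (a b c : nat * nat).

Lemma fst_expr f n : (f ^+ n).1 = f.1 ^+ n.
Proof. by elim: n => // n IH; rewrite !exprS -IH. Qed.

Lemma snd_expr f n : (f ^+ n).2 = f.2 ^+ n.
Proof. by elim: n => // n IH; rewrite !exprS -IH. Qed.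

Definition thicken B a : set fps2 :=
  [set f | exists2 b, B b & nu_ge a (f - b)].

Lemma sub_thicken B a : B `<=` thicken B a.
Proof. by move=> f Bf; exists f; rewrite // subrr; apply: nu_ge0. Qed.

Lemma ideal_thicken B a : subalgebra B -> nu_ge a `<=` thicken B a.
Proof. by move=> algB f fa; exists 0; [exact: alg0|rewrite subr0]. Qed.

Lemma thicken_subalgebra B a : subalgebra B -> subalgebra (thicken B a).
Proof.
move=> algB; apply/subalgebraP; split.
- by apply: sub_thicken; apply: alg1.
- move=> k x y [u Bu xu] [v Bv yv].
  exists (k *: u + v); first by apply: algD => //; apply: algZ.
  rewrite opprD addrACA -scalerBr; apply: nu_geD => //.
  by rewrite -[x - u]mul1r scalerAl; apply: nu_ge_mull.
- move=> x y [u Bu xu] [v Bv yv]; exists (u * v); first exact: algM.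
  rewrite (_ : _ - _ = (x - u) * y + u * (y - v)); last by ring.
  by apply: nu_geD; [apply: nu_ge_mulr|apply: nu_ge_mull].
Qed.

Lemma ord_addl_lt (f g : fps K) m n :
  ord f = Some n -> ord g = Some m -> (m < n)%N -> ord (f + g) = Some m.
Proof.
move=> /ordP[f0 _] /ordP[g0 gm] mn; apply/ordP; split.
  by apply: vanishesD => //; apply: vanishes_le f0; apply: ltnW.
by rewrite /= f0 // add0r.
Qed.

(** If [g] is zero or of order above [n], then [f + g] keeps the order of [f]. This supplies a
    finite order in the other component in the exchange argument below. *)
Lemma ord_or_ord_add (f g : fps K) n : ord f = Some n ->
  exists2 k, (k <= n)%N & ord g = Some k \/ ord (f + g) = Some k.
Proof.
move=> ordf; have /ordP[f0 fn] := ordf.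
have [g0|/eqP gN0] := eqVneq g 0.
  by exists n => //; right; rewrite g0 addr0.
have [k ordg] := ord_neq0 gN0.
have [kn|nk] := leqP k n; first by exists k => //; left.
by exists n => //; right; rewrite addrC; apply: ord_addl_lt ordg ordf nk.
Qed.

Lemma vanishes_or_ord (n : nat) (g : fps K) :
  vanishes n g \/ exists2 m, (m < n)%N & ord g = Some m.
Proof.
have [->|/eqP gN0] := eqVneq g 0; first by left.
have [k ordg] := ord_neq0 gN0.
have [nk|kn] := leqP n k; last by right; exists k.
by left; have /ordP[g0 _] := ordg; apply: vanishes_le g0.
Qed.

(* An element of minimal total order is a minimum for the componentwise order:
   otherwise one of [f] and [h + f] would have a smaller total order. *)
Lemma exists_minimum A a x p : subalgebra A ->
  A x -> nu x = fin_val p -> nu_ge a x ->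
  exists h q, [/\ A h, nu h = fin_val q, nu_ge a h &
    forall f, A f -> nu_ge a f -> nu_ge q f].
Proof.
move=> algA Ax xp xa.
pose P n := `[< exists h q, [/\ A h, nu h = fin_val q, nu_ge a h &
  (q.1 + q.2)%N = n] >].
have exP : exists n, P n by exists (p.1 + p.2)%N; apply/asboolP; exists x, p.
case: (ex_minnP exP) => n /asboolP[h [q [Ah hq ha qn]]] nmin.
have noless g r : A g -> nu_ge a g -> nu g = fin_val r ->
    (r.1 + r.2 < q.1 + q.2)%N -> False.
  move=> Ag ga gr; rewrite qn ltnNge => /negP; apply; apply: nmin.
  by apply/asboolP; exists g, r.
have [h1 h2] := (nuP _ _).1 hq.
exists h, q; split=> // f Af fa.
have Ahf : A (h + f) by apply: algD.
have hfa : nu_ge a (h + f) by apply: nu_geD.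
apply/nu_geP; split.
  have [//|[m mq f1]] := vanishes_or_ord q.1 f.1; exfalso.
  have [k kq [f2|hf2]] := ord_or_ord_add f.2 h2.
    by apply: (noless f (m, k)) => //; [apply/nuP|rewrite /= -addSn leq_add].
  apply: (noless (h + f) (m, k)) => //; last by rewrite /= -addSn leq_add.
  by apply/nuP; split=> //; apply: ord_addl_lt h1 f1 mq.
have [//|[m mq f2]] := vanishes_or_ord q.2 f.2; exfalso.
have [k kq [f1|hf1]] := ord_or_ord_add f.1 h1.
  by apply: (noless f (k, m)) => //; [apply/nuP|rewrite /= -addnS leq_add].
apply: (noless (h + f) (k, m)) => //; last by rewrite /= -addnS leq_add.
by apply/nuP; split=> //; apply: ord_addl_lt h2 f2 mq.
Qed.

Lemma vanishes1_sub_scale (v : fps K) : v 0%N != 0 ->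
  vanishes 1 (1 - (v 0%N)^-1 *: v).
Proof. by move=> v0 [|//] _ /=; rewrite mulVf // subrr. Qed.

(* The inverse is the geometric series of
   [w = (1 - v / v.1(0)) (1 - v / v.2(0))], which has the form [1 - v * s]. *)
Lemma approx_inverse A v c : subalgebra A -> A v ->
  ((0 < c.1)%N -> v.1 0%N != 0) -> ((0 < c.2)%N -> v.2 0%N != 0) ->
  exists2 u, A u & nu_ge c (v * u - 1).
Proof.
move=> algA Av v1 v2.
(* If a constant term is 0, its inverse is 0 by convention and the corresponding factor of [w] is 1;
   the matching component of [c] is then 0, so nothing is required there. *)
pose i1 : fps2 := (v.1 0%N)^-1 *: 1; pose i2 : fps2 := (v.2 0%N)^-1 *: 1.
have [Ai1 Ai2] : A i1 /\ A i2 by split; apply: algZ => //; apply: alg1.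
pose w := (1 - i1 * v) * (1 - i2 * v).
pose s := i1 + i2 - i1 * i2 * v.
have As : A s by apply: algB => //; [apply: algD|do 2?apply: algM].
have sE : v * s = 1 - w by rewrite /s /w; ring.
have Aw : A w by rewrite -(subKr 1 w) -sE; do 2?apply: algB => //;
  [apply: alg1|apply: algM].
exists (s * \sum_(i < c.1 + c.2) w ^+ i).
  by apply: algM => //; apply: alg_sum => // i; apply: algX.
rewrite mulrA sE -(opprB w 1) mulNr -subrX1 opprB addrAC subrr sub0r.
apply: nu_geN; apply/nu_geP; rewrite fst_expr snd_expr; split.
  have [->|c1] := posnP c.1; first by [].
  have w1 : vanishes 1 w.1.
    rewrite -[1%N]addn0 /w [i1 * v]mulr_algl; apply: vanishesM; last by [].
    exact: vanishes1_sub_scale (v1 c1).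
  apply: vanishes_le (@vanishesX _ _ _ (c.1 + c.2) w1).
  by rewrite muln1 leq_addr.
have [->|c2] := posnP c.2; first by [].
have w2 : vanishes 1 w.2.
  rewrite -[1%N]add0n /w [i2 * v]mulr_algl; apply: vanishesM; first by [].
  exact: vanishes1_sub_scale (v2 c2).
apply: vanishes_le (@vanishesX _ _ _ (c.1 + c.2) w2).
by rewrite muln1 leq_addl.
Qed.

(** If [q < n], then [m <= q]. With [v] of zero constant term, [h * v], and hence [x], would vanish
    in all degrees up to [q], contradicting [ord x = Some m]. *)
Lemma approx_quotient_unit (x h v : fps K) m n q :
  ord x = Some m -> ord h = Some q -> (minn m n <= q)%N ->
  vanishes n (x - h * v) -> (0 < n - q)%N -> v 0%N != 0.
Proof.
move=> /ordP[_ xm] /ordP[h0 _] mnq xhv; rewrite subn_gt0 => qn.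
apply: contra_neqN xm => /eqP v0.
have v1 : vanishes 1 v by case.
have mq : (m <= q)%N.
  by move: mnq; rewrite geq_min [(n <= q)%N]leqNgt qn orbF.
have xq : vanishes q.+1 x.
  rewrite -(subrK (h * v) x); apply: vanishesD; first exact: vanishes_le xhv.
  by rewrite -addn1; apply: vanishesM.
by apply: xq; rewrite ltnS.
Qed.

(** Modulo [nu_ge a], write [x], [x * y], [x * z] as [h * v], [h * l], [h * k] with a single [h] in
    [B] and [v], [l], [k] in the ring [colon B h]. There [v] has an approximate inverse [u], and
    [x * (y * z)] is congruent to [h * (l * (u * k))]. *)
Lemma arf_thicken B a e d : subalgebra B -> arf B ->
  B e -> nu e = fin_val d -> nu_ge (1, 1)%N e -> arf (thicken B a).
Proof.
move=> algB arfB Be ed e1; have algC := thicken_subalgebra a algB.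
apply: arfI => // x b Cx xb y z xy xz.
(* An element of [B] congruent to [x] modulo [nu_ge a] is only known to have value at least this
   minimum. *)
pose m := (minn b.1 a.1, minn b.2 a.2).
have mb : le2 m b by split; rewrite geq_minl.
have ma : le2 m a by split; rewrite geq_minr.
have [h [q [Bh hq hm hmin]]] : exists h q, [/\ B h, nu h = fin_val q,
    nu_ge m h & forall f, B f -> nu_ge m f -> nu_ge q f].
  apply: (exists_minimum algB _ (nu_exp (a.1 + a.2) ed)); first exact: algX.
  apply: nu_ge_le (nu_geX1 (a.1 + a.2) e1).
  by split; rewrite (leq_trans (geq_minr _ _)) ?leq_addr ?leq_addl.
have algL := colon_subalgebra algB arfB Bh hq.
have quot f : thicken B a f -> nu_ge m f ->
    exists2 l, colon B h l & nu_ge a (f - h * l).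
  move=> [g Bg fg] fm.
  have gm : nu_ge m g.
    by rewrite -(subKr f g); apply: nu_geB => //; apply: nu_ge_le fg.
  have [l gE] := nu_divides hq (hmin g Bg gm).
  by exists l; rewrite /colon /= -gE.
have xm : nu_ge m x by apply: nu_ge_le mb (nu_fin_ge xb).
have [v Lv xv] := quot x Cx xm.
have [l Ll xyl] := quot _ xy (nu_ge_mulr _ xm).
have [k Lk xzk] := quot _ xz (nu_ge_mulr _ xm).
have [b1 b2] := (nuP _ _).1 xb; have [q1 q2] := (nuP _ _).1 hq.
have [m1 m2] : le2 m q.
  move: hm => [].
  by rewrite /= q1 q2.
have /nu_geP[xv1 xv2] := xv.
have [u Lu vu] := approx_inverse (c := sub2 a q) algL Lv
  (approx_quotient_unit b1 q1 m1 xv1) (approx_quotient_unit b2 q2 m2 xv2).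
(* Replacing [x] by [h * v] and cancelling [h] costs [q] in precision, which the factor [h] restores
   at the end. *)
have reduce t r : nu_ge a (x * t - h * r) -> nu_ge (sub2 a q) (v * t - r).
  move=> xt; apply/(nu_ge_mulP _ _ hq).
  rewrite (_ : _ * _ = (x * t - h * r) - (x - h * v) * t); last by ring.
  by apply: nu_geB => //; apply: nu_ge_mulr.
exists (h * (l * (u * k))); first by do 2?apply: (algM algL).
rewrite (_ : _ - _ = (x - h * v) * (y * z) +
  h * ((v * y - l) * z - l * ((v * u - 1) * z - u * (v * z - k)))); last first.
  by ring.
apply: nu_geD; first exact: nu_ge_mulr.
apply/(nu_ge_mulP _ _ hq); apply: nu_geB; first exact/nu_ge_mulr/reduce.
apply: nu_ge_mull; apply: nu_geB; first exact: nu_ge_mulr.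
exact/nu_ge_mull/reduce.
Qed.

End Thickening.

(** * Gap rings, truncation and ideals inside the Arf closure *)

Section Truncation.
Variable K : fieldType.
Local Notation fps2 := (fps K * fps K)%type.
Implicit Types (A B : set fps2) (f g x y : fps2) (a b c : nat * nat).

Definition component (i : bool) f : fps K := if i then f.1 else f.2.

(** The chosen component ranges over [K + t^m K[[t]]] (in its own variable), the other one is
    free. *)
Definition gap_ring (i : bool) (m : nat) : set fps2 :=
  [set f | forall k, (0 < k < m)%N -> component i f k = 0].

Lemma componentM i f g : component i (f * g) = component i f * component i g.
Proof. by case: i. Qed.

Lemma gap_ring_subalgebra i m : subalgebra (gap_ring i m).
Proof.
apply/subalgebraP; split=> [k|k f g fD gD j jm|f g fD gD k /andP[k0 km]].
- by case: i; case: k.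
- have := fD j jm; have := gD j jm.
  by case: i {fD gD} => /= -> ->; rewrite mulr0 addr0.
- rewrite componentM /= big1 // => -[[|j] jk] _ /=.
    by rewrite subn0 gD ?mulr0 // k0.
  by rewrite fD ?mul0r //= (leq_trans _ km).
Qed.

(** If the chosen component of [x] has no constant term, it vanishes to order [m] and so do all its
    multiples. Otherwise [x] can be cancelled: [x * w] in the gap ring forces [w] into it. *)
Lemma arf_gap_ring i m : arf (gap_ring i m).
Proof.
apply: arfI; first exact: gap_ring_subalgebra.
move=> x _ Dx _ y z xy xz.
have [x0|x0] := eqVneq (component i x 0%N) 0.
  have x_vanishes : vanishes m (component i x) by case=> // k km; apply: Dx.
  move=> k /andP[_ km]; rewrite componentM.
  by rewrite (@vanishesM _ m 0 _ _ x_vanishes) // addn0.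
rewrite /colon /= mulrA; apply: (algM (gap_ring_subalgebra i m)) => //.
have cancel w : gap_ring i m (x * w) -> gap_ring i m w.
  move=> xw k /andP[k0 km]; have := xw k; rewrite k0 km => /(_ isT).
  rewrite componentM /= big_ord_recl /= subn0 big1 ?addr0 => [|j _].
    by move/eqP; rewrite mulf_eq0 (negbTE x0) => /eqP.
  by rewrite Dx ?mul0r //=; apply: leq_ltn_trans (ltn_ord j) km.
exact: cancel.
Qed.

Lemma nu_ge_trunc c (p q : fps K) :
  nu_ge (c.1 + 2, c.2 + 2)%N
    ((p, q) - (trunc (c.1 + 1) p, trunc (c.2 + 1) q)).
Proof.
have sub_trunc d (r : fps K) : vanishes (d + 2) (r - trunc (d + 1) r).
  by move=> k; rewrite addn2 ltnS -addn1 /= => ->; rewrite subrr.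
by apply/nu_geP; split; apply: sub_trunc.
Qed.

Lemma vanishes_trunc m d (p : fps K) : vanishes m p -> vanishes m (trunc d p).
Proof. by move=> p0 k km /=; rewrite p0 // if_same. Qed.

(** One of [f i], [f j] and [f i + f j] has both components nonzero. *)
Lemma exists_positive_finite A (I : Type) (f : I -> fps2) : subalgebra A ->
  (forall i, A (f i)) -> (forall i, nu_ge (1, 1)%N (f i)) ->
  (exists i, (f i).1 <> 0) -> (exists i, (f i).2 <> 0) ->
  exists e d, [/\ A e, nu e = fin_val d & nu_ge (1, 1)%N e].
Proof.
move=> algA Af f1 [i fi] [j fj].
have fin x : x.1 <> 0 -> x.2 <> 0 -> exists d, nu x = fin_val d.
  move=> x1 x2; have [k1 o1] := ord_neq0 x1.
  have [k2 o2] := ord_neq0 x2.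
  by exists (k1, k2); apply/nuP.
have [fi2|/eqP fi2] := eqVneq (f i).2 0; last first.
  by have [d fid] := fin _ fi fi2; exists (f i), d.
have [fj1|/eqP fj1] := eqVneq (f j).1 0; last first.
  by have [d fjd] := fin _ fj1 fj; exists (f j), d.
have [d fd] : exists d, nu (f i + f j) = fin_val d.
  by apply: fin; rewrite /= ?fj1 ?fi2 ?addr0 ?add0r.
by exists (f i + f j), d; split=> //; [apply: algD|apply: nu_geD].
Qed.

(* Otherwise the Arf closure would lie in a gap ring, which misses the value
   [c + (1, 0)] or [c + (0, 1)]. *)
Lemma exists_low_component i n (f : 'I_n -> fps2) c :
  (forall a, values (arf_closure (power_series_ring f)) (add2 c a)) ->
  exists j, ~ vanishes ((if i then c.1 else c.2) + 2) (component i (f j)).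
Proof.
set m := (if i then _ else _) => cA; apply: contrapT => nex.
have fm j : vanishes (m + 2) (component i (f j)).
  by apply: contrapT => fj; apply: nex; exists j.
have algD' := gap_ring_subalgebra i (m + 2).
have AD : arf_closure (power_series_ring f) `<=` gap_ring i (m + 2).
  apply: arf_closure_min; first exact: arf_gap_ring.
  apply: power_series_min => //.
    apply: (closed_of_ideal (a := (m + 2, m + 2)%N)) => // x /nu_geP[x1 x2].
    by move=> k /andP[_ km]; case: (i); [apply: x1|apply: x2].
  by move=> j k /andP[_ km]; apply: fm.
have [x /AD Dx] := cA (nat_of_bool i, nat_of_bool (~~ i)).
move=> /nuP[/ordP[_ x1] /ordP[_ x2]].
have := Dx m.+1; rewrite addn2 ltnS leqnn => /(_ isT) /eqP; apply/negP.
by rewrite /m; case: (i) x1 x2 => /=; rewrite ?addn1 ?addn0.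
Qed.

(** Division by [x] shows that every pair is congruent modulo [nu_ge (2, 2)] to an element of the
    colon. For [k > 0], the [k]-th power of an approximation of [(t, 0)] has second component of
    order at least [2 * k], hence at least [k.+1]: this is what the precision [c + 2] is for. *)
Lemma colon_staircase A x c : subalgebra A -> arf A -> A x ->
  nu x = fin_val c -> nu_ge c `<=` thicken A (c.1 + 2, c.2 + 2)%N ->
  staircase (colon A x) (0, 0)%N.
Proof.
move=> algA arfA Ax xc cA; have algL := colon_subalgebra algA arfA Ax xc.
have L2 g : exists2 l, colon A x l & nu_ge (2, 2)%N (g - l).
  have [b Ab xgb] := cA (x * g) (nu_ge_mulr _ (nu_fin_ge xc)).
  have bc : nu_ge c b.
    rewrite -(subKr (x * g) b); apply: nu_geB; first exact/nu_ge_mulr/nu_fin_ge.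
    by apply: nu_ge_le xgb; split; rewrite /= leq_addr.
  have [l bE] := nu_divides xc bc.
  exists l; first by rewrite /colon /= -bE.
  by apply: (nu_ge_cancel xc); rewrite mulrBr -bE.
have coefE (p q : fps K) k : vanishes 2 (p - q) -> (k < 2)%N -> q k = p k.
  by move=> pq k2; have /eqP := pq k k2; rewrite /= subr_eq0 => /eqP.
move=> k; rewrite !add0n; split.
  have [->|k0] := posnP k.
    (* A zeroth power would be 1, whose second component does not vanish, so [(1, 0)] is
       approximated directly. *)
    have [l Ll /nu_geP[/= l1 l2]] := L2 (1, 0).
    exists l; split=> //; last by rewrite (coefE _ _ _ l1) //= oner_eq0.
    by apply/nu_geP; split=> // -[|//] _; rewrite (coefE _ _ _ l2).
  have [l Ll /nu_geP[/= l1 l2]] := L2 (fps_monomial K 1, 0).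
  have l1v : vanishes 1 l.1 by case=> // _; rewrite (coefE _ _ _ l1).
  have l2v : vanishes 2 l.2.
    by move=> j j2; rewrite (coefE _ _ _ l2).
  exists (l ^+ k); split; first exact: algX.
    apply/nu_geP; rewrite fst_expr snd_expr /=; split.
      by have := @vanishesX _ _ _ k l1v; rewrite muln1.
    apply: vanishes_le (@vanishesX _ _ _ k l2v).
    by rewrite muln2 -addnn -addn1 leq_add2l.
  have := @coefsX_lead _ _ _ k l1v; rewrite muln1 fst_expr => ->.
  by rewrite (coefE _ _ _ l1) //= expr1n oner_eq0.
have [->|k0] := posnP k.
  have [l Ll /nu_geP[/= l1 l2]] := L2 (0, 1).
  exists l; split=> //; last by rewrite (coefE _ _ _ l2) //= oner_eq0.
  by apply/nu_geP; split=> // -[|//] _; rewrite (coefE _ _ _ l1).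
have [l Ll /nu_geP[/= l1 l2]] := L2 (0, fps_monomial K 1).
have l2v : vanishes 1 l.2 by case=> // _; rewrite (coefE _ _ _ l2).
have l1v : vanishes 2 l.1.
  by move=> j j2; rewrite (coefE _ _ _ l1).
exists (l ^+ k); split; first exact: algX.
  apply/nu_geP; rewrite fst_expr snd_expr /=; split.
    apply: vanishes_le (@vanishesX _ _ _ k l1v).
    by rewrite muln2 -addnn -addn1 leq_add2l.
  by have := @vanishesX _ _ _ k l2v; rewrite muln1.
have := @coefsX_lead _ _ _ k l2v; rewrite muln1 snd_expr => ->.
by rewrite (coefE _ _ _ l2) //= expr1n oner_eq0.
Qed.

(** The colon by [x] consists of fractions of [S] and has a staircase at [(0, 0)], so [S] contains
    some [nu_ge a]. The colon then contains it too and is everything; multiplying by [x] gives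
    [nu_ge c]. *)
Lemma ideal_of_thicken S c e d : subalgebra S -> adic_closure S `<=` S ->
  S e -> nu e = fin_val d -> nu_ge (1, 1)%N e ->
  values (arf_closure S) c ->
  @nu_ge K c `<=` thicken (arf_closure S) (c.1 + 2, c.2 + 2)%N ->
  @nu_ge K c `<=` arf_closure S.
Proof.
move=> algS closedS Se ed e1 [x Bx xc] cB.
have algB := arf_closure_subalgebra algS; have arfB := arf_arf_closure S.
have algL := colon_subalgebra algB arfB Bx xc.
have Lc := colon_staircase algB arfB Bx xc cB.
have BQ := arf_closure_fractions algS.
have LQ : colon (arf_closure S) x `<=` fractions S.
  move=> y xy; apply: (fractions_cancel algS xc); [exact: BQ|exact: BQ].
have [a aS] := fractions_ideal algS closedS Se ed e1 (staircase_sub LQ Lc).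
have aL : @nu_ge K a `<=` colon (arf_closure S) x.
  by move=> y ya; apply: sub_arf_closure; apply: aS; apply: nu_ge_mull.
move=> f fc; have [g ->] := nu_divides xc fc.
exact: (staircase_ideal algL Lc aL (nu_ge00 g)).
Qed.

(** Values alone only give approximations by elements of the Arf closure. They become exact once the
    power series ring contains some [nu_ge a], which its completeness provides through
    [fractions_ideal]. *)
Lemma conductor_ideal n (f : 'I_n -> fps2) c :
  (forall a, values (arf_closure (power_series_ring f)) (add2 c a)) ->
  @nu_ge K c `<=` arf_closure (power_series_ring f).
Proof.
set R := power_series_ring f => cA.
have algR : subalgebra R by apply: power_series_subalgebra.
have RQ := arf_closure_fractions algR.
have Ac := staircase_values cA.
(* Clearing the denominator of an element of value [c + (1, 1)] gives an element of [R] of positive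
   finite value. *)
have [e [d [Re ed e1]]] :
    exists e d, [/\ R e, nu e = fin_val d & nu_ge (1, 1)%N e].
  have [x /RQ[w [a [Rw wa Rwx]]] xc] := cA (1, 1)%N.
  exists (w * x), (add2 a (add2 c (1, 1)%N)); split=> //; first exact: nu_mul.
  apply: nu_ge_mull; apply: nu_ge_le (nu_fin_ge xc).
  by split; rewrite /= leq_addl.
have [a aR] := fractions_ideal algR (@adic_closure_closed _ _) Re ed e1
  (staircase_sub RQ Ac).
apply: (staircase_ideal (arf_closure_subalgebra algR) Ac (a := a)) => y ya.
by apply: sub_arf_closure; apply: aR.
Qed.

Lemma nu_eq_of_sub c x y : nu x = fin_val c ->
  nu_ge (c.1.+1, c.2.+1)%N (x - y) -> nu y = fin_val c.
Proof.
have ord_eq (p q : fps K) m : ord p = Some m -> vanishes m.+1 (p - q) ->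
    ord q = Some m.
  move=> /ordP[p0 pm] pq; have pqE k : (k <= m)%N -> q k = p k.
    by move=> km; have /eqP := pq k km; rewrite /= subr_eq0 => /eqP.
  by apply/ordP; split=> [k km|]; rewrite pqE // ?p0 // ltnW.
move=> /nuP[x1 x2] /nu_geP[xy1 xy2]; apply/nuP.
by split; [apply: ord_eq xy1|apply: ord_eq xy2].
Qed.

End Truncation.

(** * Equality of the two Arf closures *)

Theorem corollary4p3 (K : fieldType) (n : nat) (phi psi : 'I_n -> fps K)
    (c : nat * nat) :
  infinite_set [set: K] ->
  two_branch_curve (fun i => (phi i, psi i)) ->
  is_conductor
    (values (arf_closure (power_series_ring (fun i => (phi i, psi i))))) c ->
  arf_closure (power_series_ring (fun i => (phi i, psi i))) =
  arf_closure (power_series_ring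
    (fun i => (trunc (c.1 + 1) (phi i), trunc (c.2 + 1) (psi i)))).
Proof.
move=> _ [f1 _] [cA _].
set f := fun i => (phi i, psi i) in f1 cA *.
set g := fun i => _; set R := power_series_ring f; set S := power_series_ring g.
have [algR algS] : subalgebra R /\ subalgebra S.
  by split; apply: power_series_subalgebra.
have [algA algB] := (arf_closure_subalgebra algR, arf_closure_subalgebra algS).
have [arfA arfB] := (arf_arf_closure R, arf_arf_closure S).
have fg i : nu_ge (c.1 + 2, c.2 + 2)%N (f i - g i) by apply: nu_ge_trunc.
have cAI := conductor_ideal cA.
have BA : arf_closure S `<=` arf_closure R.
  apply: arf_closure_min => //; apply: power_series_min => // [|i].
    exact: (closed_of_ideal algA cAI).
  apply: (algBl algA (x := f i)).
    by apply: sub_arf_closure; apply: power_series_gen.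
  by apply: cAI; apply: nu_ge_le (fg i); split; rewrite /= leq_addr.
have [e [d [Se ed e1]]] :
    exists e d, [/\ S e, nu e = fin_val d & nu_ge (1, 1)%N e].
  apply: (exists_positive_finite (f := g) algS) => [i|i||].
  - exact: power_series_gen.
  - have /nu_geP[phi1 psi1] := f1 i.
    by apply/nu_geP; split; apply: vanishes_trunc.
  (* A generator with a term of degree at most [c.1 + 1] keeps it under truncation. *)
  - have [j fj] := exists_low_component true cA; exists j => gj; apply: fj.
    by have /nu_geP[/= fg1 _] := fg j; move: gj fg1 => /= ->; rewrite subr0.
  - have [j fj] := exists_low_component false cA; exists j => gj; apply: fj.
    by have /nu_geP[/= _ fg2] := fg j; move: gj fg2 => /= ->; rewrite subr0.
have AC : arf_closure R `<=` thicken (arf_closure S) (c.1 + 2, c.2 + 2)%N.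
  have algC := thicken_subalgebra (c.1 + 2, c.2 + 2)%N algB.
  apply: arf_closure_min.
    by apply: (arf_thicken _ algB arfB _ ed e1); apply: sub_arf_closure.
  apply: power_series_min => // [|i].
    exact: (closed_of_ideal algC (ideal_thicken algB)).
  by exists (g i) => //; apply: sub_arf_closure; apply: power_series_gen.
have cBI : @nu_ge K c `<=` arf_closure S.
  apply: (ideal_of_thicken algS _ Se ed e1).
  - exact: adic_closure_closed.
  (* An element of value [c] keeps its value when changed by [nu_ge (c.1 + 2, c.2 + 2)], so the
     value [c] passes to [arf_closure S]. *)
  - have [x Ax xc] := cA (0, 0)%N; rewrite /add2 /= !addn0 in xc.
    have [b Bb xb] := AC x Ax; exists b => //.
    move: xc; rewrite -surjective_pairing => xc; apply: (nu_eq_of_sub xc).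
    by apply: nu_ge_le xb; split; rewrite /= addn2.
  - by move=> x xc; apply: AC; apply: cAI.
apply/seteqP; split=> //; apply: arf_closure_min => //.
apply: power_series_min => // [|i]; first exact: (closed_of_ideal algB cBI).
rewrite -(subrK (g i) (f i)); apply: (algD algB).
  by apply: cBI; apply: nu_ge_le (fg i); split; rewrite /= leq_addr.
by apply: sub_arf_closure; apply: power_series_gen.
Qed.
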